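(* For each of the two problems ''discrete $k$-median in the $\ell_1$-metric'' and ''discrete $k$-means in the $\ell_2$-metric'', and for every $\varepsilon>0$, there exist $\delta>0$ and a family of well-separated instances (for infinitely many values of $k$) such that for every instance in the family, the minimum cost of an integral solution that is allowed to open up to $k+\delta k$ centers is at least $\left(\frac{149}{125}-\varepsilon\right)$ times the optimal value of the basic SDP relaxation of the instance with parameter $k$. That is, the SDP relaxation has a gap of at least $149/125-\varepsilon\approx1.192-\varepsilon$, even when the integral solution opens $\Omega(k)$ more centers.
   Context: An instance consists of a finite set $\mathcal{C}\subset\mathbb{R}^N$ of candidate centers, a finite set $\mathcal{P}\subset\mathbb{R}^N$ of points, and $k\in\mathbb{N}$. For $p\in\mathcal{P}$, $c\in\mathcal{C}$, let $d_{p,c}=\|p-c\|_1$ for $k$-median in $\ell_1$, and $d_{p,c}=\|p-c\|_2^2$ for $k$-means in $\ell_2$. An integral solution opening a set $C\subseteq\mathcal{C}$ has cost $\sum_{p\in\mathcal{P}}\min_{c\in C}d_{p,c}$. The basic SDP relaxation has vector variables $v_0$, $v_{p,c}$ ($p\in\mathcal{P},c\in\mathcal{C}$), $u_c$ ($c\in\mathcal{C}$) in a Euclidean space of arbitrary finite dimension: minimize $\sum_{p\in\mathcal{P}}\sum_{c\in\mathcal{C}}\|v_{p,c}\|_2^2\,d_{p,c}$ subject to $\langle v_0,v_0\rangle=1$; $\langle v_{p,c},v_0\rangle=\|v_{p,c}\|_2^2$ for all $p,c$; $\langle u_c,v_0\rangle=\|u_c\|_2^2$ for all $c$; $\langle v_{p,c},u_c\rangle=\|v_{p,c}\|_2^2$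 for all $p,c$; $\|\sum_{c\in\mathcal{C}}v_{p,c}-v_0\|_2^2=0$ for all $p$; and $\sum_{c\in\mathcal{C}}\|u_c\|_2^2\le k$. An instance is well-separated if, after normalizing so that the average connection cost of a point in the SDP solution is $1$, every pair of distinct points in $\mathcal{P}\cup\mathcal{C}$ is at distance at least $1$. *)

(* Defs.v *)
From HB Require Import structures.
From mathcomp Require Import all_boot all_order all_algebra.
From mathcomp Require Import finmap.
From mathcomp Require Import all_classical all_reals all_analysis.

Set Implicit Arguments.
Unset Strict Implicit.
Unset Printing Implicit Defensive.

Import Order.TTheory GRing.Theory Num.Theory.

Local Open Scope fset_scope.
Local Open Scope ring_scope.

Section Norms.
Variables (R : realType) (n : nat).

(* The library norm on row vectors is the sup norm, hence these. *)
Definition dotp (u v : 'rV[R]_n) : R := \sum_(i < n) u 0 i * v 0 i.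
Definition l1norm (u : 'rV[R]_n) : R := \sum_(i < n) `|u 0 i|.
Definition l2norm (u : 'rV[R]_n) : R := Num.sqrt (dotp u u).

End Norms.

Variant problem := kmedian_l1 | kmeans_l2.

Definition pdist (R : realType) (pb : problem) (n : nat) (x y : 'rV[R]_n) : R :=
  match pb with
  | kmedian_l1 => l1norm (x - y)
  | kmeans_l2 => l2norm (x - y)
  end.

Definition conn_cost (R : realType) (pb : problem) (n : nat)
    (x y : 'rV[R]_n) : R :=
  match pb with
  | kmedian_l1 => l1norm (x - y)
  | kmeans_l2 => l2norm (x - y) ^+ 2
  end.

Record instance (R : realType) := Instance {
  dim : nat;
  points : {fset 'rV[R]_dim};
  centers : {fset 'rV[R]_dim};
  budget : nat
}.

Section Clustering.
Variables (R : realType) (pb : problem) (I : instance R).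

(* A minimum over the empty set of centers is +oo. *)
Definition integral_cost (S : {set centers I}) : \bar R :=
  (\sum_(p : points I)
     \big[mine/+oo]_(c in S) (conn_cost pb (val p) (val c))%:E)%E.

Definition opt_integral (b : R) : \bar R :=
  (\big[mine/+oo]_(S : {set centers I} | (#|S|%:R <= b)%R) integral_cost S)%E.

Definition sdp_feasible (m : nat) (v0 : 'rV[R]_m)
    (v : points I -> centers I -> 'rV[R]_m) (u : centers I -> 'rV[R]_m) : Prop :=
  [/\ dotp v0 v0 = 1,
      (forall p c, dotp (v p c) v0 = l2norm (v p c) ^+ 2)
      /\ (forall c, dotp (u c) v0 = l2norm (u c) ^+ 2),
      forall p c, dotp (v p c) (u c) = l2norm (v p c) ^+ 2,
      forall p, l2norm (\sum_(c : centers I) v p c - v0) ^+ 2 = 0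
    & \sum_(c : centers I) l2norm (u c) ^+ 2 <= (budget I)%:R].

Definition sdp_objective (m : nat)
    (v : points I -> centers I -> 'rV[R]_m) : R :=
  \sum_(p : points I) \sum_(c : centers I)
     l2norm (v p c) ^+ 2 * conn_cost pb (val p) (val c).

(* +oo when the relaxation is infeasible *)
Definition sdp_value : \bar R :=
  ereal_inf [set x : \bar R |
    exists (m : nat) (v0 : 'rV[R]_m)
           (v : points I -> centers I -> 'rV[R]_m) (u : centers I -> 'rV[R]_m),
      sdp_feasible v0 v u /\ x = (sdp_objective v)%:E]%classic.

End Clustering.

Definition scale_instance (R : realType) (s : R) (I : instance R) : instance R :=
  @Instance R (dim I) [fset s *: x | x in points I]
    [fset s *: x | x in centers I] (budget I).

(* Not 1 when there are no points, as then it is 0 (since 0^-1 = 0), nor when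
   the relaxation is infeasible. *)
Definition avg_sdp_cost (R : realType) (pb : problem) (I : instance R) : \bar R :=
  (sdp_value pb I * ((#|` points I|%:R)^-1)%:E)%E.

Definition well_separated (R : realType) (pb : problem) (I : instance R) : Prop :=
  exists2 s : R, 0 < s &
    let J := scale_instance s I in
    avg_sdp_cost pb J = 1%E /\
    (forall x y, x \in points J `|` centers J -> y \in points J `|` centers J ->
       x != y -> 1 <= pdist pb x y).

(* Main.v *)
(* The instance encodes partial vertex cover on the complete graph K_n: the
   centers are the basis vectors e_i, the points are the sums e_i + e_j, and
   k = 2n/3.  For both problems a point is at cost 1 from its two endpoints and
   at cost 3 from every other center.  A set of at most (1 + delta) k centers
   misses about (1/3 - 2 delta/3) n vertices, hence leaves nearly 1/9 of the
   points at cost 3, so the integral cost is nearly 11/9 > 149/125 per point.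
   The relaxation has cost exactly 1 per point: with pairwise orthogonal
   w_i of squared norm 2/9, all orthogonal to v_0, one may take
   u_i = (2/3) v_0 + w_i and v_{ij,i} = v_0/2 + (3/4) (w_i - w_j). *)
Require Import Defs.
From mathcomp Require Import all_boot all_order all_algebra finmap.
From mathcomp Require Import all_classical all_reals all_analysis.
From mathcomp Require Import ring lra.
From mathcomp Require Import fintype finset.
Import Order.TTheory GRing.Theory Num.Theory.
Local Open Scope ring_scope.
Set Implicit Arguments.
Unset Strict Implicit.
Unset Printing Implicit Defensive.

(** Moves sums over the points and centers, which are finite sets of vectors, to sums over edges and
    vertices. *)
Lemma sum_fset_image (T : finType) (U : choiceType) (V : nmodType) (A : {set T})
    (f : T -> U) (G : U -> V) : injective f ->
  \sum_(x : [fset f a | a in A]%fset) G (val x) = \sum_(a in A) G (f a).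
Proof.
move=> f_inj; rewrite -(big_seq_fsetE _ _ predT) big_imfset /=.
  by rewrite -[RHS]big_enum; apply/perm_big/uniq_perm; rewrite ?enum_uniq.
by move=> x y _ _ /f_inj.
Qed.

(** * Inner product on row vectors *)

Section DotProduct.
Context {R : realType}.

Lemma dotpZl n (a : R) (x y : 'rV_n) : dotp (a *: x) y = a * dotp x y.
Proof. by rewrite /dotp mulr_sumr; apply: eq_bigr => i _; rewrite mxE mulrA. Qed.

Lemma dotpC n (x y : 'rV[R]_n) : dotp x y = dotp y x.
Proof. by apply: eq_bigr => i _; rewrite mulrC. Qed.

Lemma dotpZr n (a : R) (x y : 'rV_n) : dotp x (a *: y) = a * dotp x y.
Proof. by rewrite dotpC dotpZl dotpC. Qed.

Lemma dotpDl n (x y z : 'rV[R]_n) : dotp (x + y) z = dotp x z + dotp y z.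
Proof.
by rewrite /dotp -big_split; apply: eq_bigr => i _; rewrite mxE mulrDl.
Qed.

Lemma dotpBl n (x y z : 'rV[R]_n) : dotp (x - y) z = dotp x z - dotp y z.
Proof. by rewrite dotpDl -scaleN1r dotpZl mulN1r. Qed.

Lemma dotpBr n (x y z : 'rV[R]_n) : dotp z (x - y) = dotp z x - dotp z y.
Proof. by rewrite ![dotp z _]dotpC dotpBl. Qed.

Lemma dotp0l n (x : 'rV[R]_n) : dotp 0 x = 0.
Proof. by rewrite -[0](scale0r x) dotpZl mul0r. Qed.

Lemma dotp_suml n (T : finType) (x : T -> 'rV[R]_n) y :
  dotp (\sum_i x i) y = \sum_i dotp (x i) y.
Proof.
by apply: (big_morph (fun z => dotp z y)) => [u v|]; rewrite ?dotpDl ?dotp0l.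
Qed.

Lemma dotp_row_mx n1 n2 (x1 y1 : 'rV[R]_n1) (x2 y2 : 'rV_n2) :
  dotp (row_mx x1 x2) (row_mx y1 y2) = dotp x1 y1 + dotp x2 y2.
Proof.
by rewrite /dotp big_split_ord; congr (_ + _); apply: eq_bigr => i _;
  rewrite ?row_mxEl ?row_mxEr.
Qed.

Lemma dotp_ge0 n (x : 'rV[R]_n) : 0 <= dotp x x.
Proof. by apply: sumr_ge0 => i _; rewrite -expr2 sqr_ge0. Qed.

Lemma sqr_l2norm n (x : 'rV[R]_n) : l2norm x ^+ 2 = dotp x x.
Proof. exact: sqr_sqrtr (dotp_ge0 x). Qed.

Lemma dotp_eq0 n (x : 'rV[R]_n) : dotp x x = 0 -> x = 0.
Proof.
move/eqP; rewrite psumr_eq0 => [/allP x0|i _]; last by rewrite -expr2 sqr_ge0.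
apply/rowP => i; apply/eqP; rewrite mxE -sqrf_eq0 expr2.
exact: x0 (mem_index_enum i).
Qed.

End DotProduct.

(** * Indicator vectors and their distances *)

Section Indicator.
Context {R : realType} {n : nat}.
Implicit Types A B : {set 'I_n}.

Definition indic A : 'rV[R]_n := \row_i (i \in A)%:R.

Lemma dotp_indic A B : dotp (indic A) (indic B) = #|A :&: B|%:R.
Proof.
rewrite -sum1_card natr_sum /dotp [RHS]big_mkcond; apply: eq_bigr => i _.
by rewrite !mxE inE; do 2!case: (_ \in _); rewrite ?mulr0 ?mul0r ?mulr1.
Qed.

Lemma indic_inj : injective indic.
Proof.
move=> A B /rowP AB; apply/setP => i; have := AB i; rewrite !mxE.
by do 2!case: (_ \in _) => //; move/eqP; rewrite ?oner_eq0 // eq_sym oner_eq0.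
Qed.

(** Each coordinate of the difference is -1, 0 or 1, where absolute value and square agree. This
    lets one instance serve both problems. *)
Lemma l1norm_indicB A B :
  l1norm (indic A - indic B) = dotp (indic A - indic B) (indic A - indic B).
Proof.
apply: eq_bigr => i _; rewrite !mxE.
by do 2!case: (_ \in _);
  rewrite ?subrr ?subr0 ?sub0r ?normrN ?normr0 ?normr1 ?mulr0 ?mulrNN ?mulr1.
Qed.

(** Both costs count the symmetric difference of [A] and [B]. *)
Lemma conn_cost_indic pb A B :
  conn_cost pb (indic A) (indic B) =
    #|A|%:R + #|B|%:R - 2 * #|A :&: B|%:R.
Proof.
have -> : conn_cost pb (indic A) (indic B) =
    dotp (indic A - indic B) (indic A - indic B).
  by case: pb => /=; rewrite ?l1norm_indicB ?sqr_l2norm.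
rewrite dotpBl !dotpBr !dotp_indic !setIid [B :&: A]setIC; ring.
Qed.

(** A coordinate where the two sets differ already contributes 1 to the squared distance. *)
Lemma pdist_indic_ge1 pb A B : A != B -> 1 <= pdist pb (indic A) (indic B).
Proof.
move=> neqAB.
have dist2_ge1 : 1 <= dotp (indic A - indic B) (indic A - indic B).
  have [i ABi] : exists i, (i \in A) != (i \in B).
    apply/existsP; apply: contraR neqAB; rewrite negb_exists => /forallP e.
    by apply/eqP/setP => i; apply/eqP; rewrite -[_ == _]negbK.
  rewrite /dotp (bigD1 i) //= !mxE -[leLHS]addr0 lerD //.
    by move: ABi; do 2!case: (_ \in _) => //=; rewrite ?subr0 ?sub0r ?mulrNN ?mulr1.
  by apply: sumr_ge0 => j _; rewrite -expr2 sqr_ge0.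
case: pb => /=; rewrite ?l1norm_indicB // /l2norm.
by rewrite -[leLHS]sqrtr1 ler_wsqrtr.
Qed.

End Indicator.

(** * The complete-graph instance and its SDP solution *)

Section CompleteGraph.
Context {R : realType} (n k : nat).

Definition complete_instance : instance R :=
  @Instance R n
    [fset (indic A : 'rV[R]_n) | A in [set A : {set 'I_n} | #|A| == 2]]%fset
    [fset (indic [set i] : 'rV[R]_n) | i in [set: 'I_n]]%fset k.

Local Notation I := complete_instance.

Lemma indic1_inj : injective (fun i : 'I_n => indic [set i] : 'rV[R]_n).
Proof. by move=> i j /indic_inj /set1_inj. Qed.

Lemma pointP (p : points I) : exists2 A : {set 'I_n}, #|A| = 2 & val p = indic A.
Proof.
by have /imfsetP[A /=] := valP p; rewrite inE => /eqP A2 ->; exists A.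
Qed.

Lemma centerP (c : centers I) : exists i : 'I_n, val c = indic [set i].
Proof. by have /imfsetP[i /= _ ->] := valP c; exists i. Qed.

Lemma sum_points (V : nmodType) (G : 'rV[R]_n -> V) :
  \sum_(p : points I) G (val p) = \sum_(A : {set 'I_n} | #|A| == 2) G (indic A).
Proof.
rewrite sum_fset_image; last exact: indic_inj.
by apply: eq_bigl => A; rewrite inE.
Qed.

Lemma sum_centers (V : nmodType) (G : 'rV[R]_n -> V) :
  \sum_(c : centers I) G (val c) = \sum_i G (indic [set i]).
Proof.
rewrite sum_fset_image; last exact: indic1_inj.
by apply: eq_bigl => A; rewrite inE.
Qed.

Lemma card_points : #|` points I| = 'C(n, 2).
Proof.
rewrite finmap.card_fset_sum1 (big_seq_fsetE _ _ predT) (sum_points (fun=> 1%N)).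
by rewrite sum1dep_card card_draws card_ord.
Qed.

Lemma cost_center pb (A : {set 'I_n}) (i : 'I_n) : #|A| = 2 ->
  conn_cost pb (indic A : 'rV[R]_n) (indic [set i]) = if i \in A then 1 else 3.
Proof.
move=> A2; rewrite conn_cost_indic A2 cards1; case: ifPn => iA.
  rewrite (setIidPr _) ?sub1set // cards1; ring.
suff -> : A :&: [set i] = set0 by rewrite cards0; ring.
by apply/eqP; rewrite setIC setI_eq0 disjoints1.
Qed.

(* The coordinates orthogonal to [v0] are doubled so that the squared norm 2/9
   needed for the [u_c] does not require a square root. *)
Definition sdp_vec (a : R) (x : 'rV[R]_n) : 'rV[R]_(1 + (n + n)) :=
  row_mx (const_mx a) (row_mx x x).

Lemma dotp_sdp_vec a b x y :
  dotp (sdp_vec a x) (sdp_vec b y) = a * b + 2 * dotp x y.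
Proof.
rewrite !dotp_row_mx {1}/dotp big_ord1 !mxE; ring.
Qed.

Lemma sum_sdp_vec (T : finType) (P : pred T) a x :
  \sum_(i | P i) sdp_vec (a i) (x i) =
  sdp_vec (\sum_(i | P i) a i) (\sum_(i | P i) x i).
Proof.
apply: (big_rec3 (fun v b y => v = sdp_vec b y)) => [|i v b y _ ->].
  by rewrite /sdp_vec row_mx0 (_ : const_mx 0 = 0) ?row_mx0.
rewrite /sdp_vec !add_row_mx; congr row_mx.
by apply/rowP => j; rewrite !mxE.
Qed.

Definition sdp_v0 := sdp_vec 1 0.
Definition sdp_u (c : centers I) := sdp_vec (2 / 3) (3^-1 *: val c).
(** The test selects the two endpoints of the edge. For the edge ij and the center i,
    [2 *: val c - val p] is e_i - e_j, and 1/4 is the product of 3/4 and the factor 1/3 in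
    [sdp_u]. *)
Definition sdp_v (p : points I) (c : centers I) :=
  if dotp (val p) (val c) == 1
  then sdp_vec 2^-1 (4^-1 *: (2 *: val c - val p)) else 0.

Lemma dotp_indic1 (A : {set 'I_n}) (i : 'I_n) :
  dotp (indic A) (indic [set i]) = (i \in A)%:R :> R.
Proof.
rewrite dotp_indic; congr _%:R; case: (boolP (i \in A)) => iA.
  by rewrite (setIidPr _) ?sub1set // cards1.
by apply/eqP; rewrite cards_eq0 setIC setI_eq0 disjoints1.
Qed.

(** Each [sdp_u c] has squared norm 4/9 + 2/9 = 2/3, so the budget constraint reads 2n/3 <= k. *)
Lemma sdp_feasible_complete : (2 * n <= 3 * k)%N ->
  sdp_feasible sdp_v0 sdp_v sdp_u.
Proof.
move=> kn.
(* Case analysis on [sdp_v p c]: zero, or the explicit vector when the center is an endpoint of the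
   edge. *)
have vP p c (P : 'rV_(1 + (n + n)) -> Prop) : P 0 ->
    (forall (A : {set 'I_n}) i, #|A| = 2 -> i \in A ->
      val c = indic [set i] -> val p = indic A ->
      P (sdp_vec 2^-1 (4^-1 *: (2 *: indic [set i] - indic A)))) ->
    P (sdp_v p c).
  rewrite /sdp_v => P0 PA; have [A A2 ep] := pointP p; have [i ec] := centerP c.
  rewrite ep ec dotp_indic1; case: (boolP (i \in A)) => iA.
    by rewrite eqxx; apply: PA.
  by rewrite eq_sym oner_eq0.
(* This is the squared norm of e_i - e_j. A nonzero [sdp_v p c] thus has squared norm 1/4 + 2 (1/16)
   2 = 1/2. *)
have dv (A : {set 'I_n}) i : #|A| = 2 -> i \in A ->
    dotp (2 *: indic [set i] - indic A) (2 *: indic [set i] - indic A) = 2 :> R.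
  move=> A2 iA; rewrite dotpBl !dotpBr !dotpZl !dotpZr !(dotpC (indic [set i])).
  by rewrite !dotp_indic1 dotp_indic setIid A2 iA mulr1n !inE eqxx mulr1n; ring.
split.
- by rewrite dotp_sdp_vec dotp0l; ring.
- split=> [p c|c].
    rewrite sqr_l2norm; elim/vP: (sdp_v p c); first by rewrite !dotp0l.
    move=> A i A2 iA _ _; rewrite !dotp_sdp_vec !dotpZl !dotpZr dv //
      (dotpC _ 0) dotp0l; by field.
  rewrite sqr_l2norm !dotp_sdp_vec (dotpC _ 0) dotp0l dotpZl dotpZr.
  have [i ->] := centerP c; rewrite dotp_indic1 !inE eqxx mulr1n; by field.
(* For an endpoint the product is (1/2)(2/3) + 2 (1/4)(1/3)(2 - 1) = 1/2. *)
- move=> p c; rewrite sqr_l2norm /sdp_u; elim/vP: (sdp_v p c); first by rewrite !dotp0l.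
  move=> A i A2 iA -> _; rewrite !dotp_sdp_vec !dotpZl !dotpZr dv // dotpBl dotpZl.
  by rewrite !dotp_indic1 iA mulr1n !inE eqxx mulr1n; by field.
(* Over the two endpoints the halves of v_0 add up to v_0, while e_i - e_j and e_j - e_i cancel. *)
- move=> p; rewrite sqr_l2norm.
  suff -> : \sum_c sdp_v p c = sdp_v0 by rewrite subrr dotp0l.
  have [A A2 ep] := pointP p.
  rewrite (sum_centers (fun x => if dotp (val p) x == 1
    then sdp_vec 2^-1 (4^-1 *: (2 *: x - val p)) else 0)).
  rewrite -big_mkcond /= ep.
  under eq_bigl => i do rewrite dotp_indic1 pnatr_eq1 eqb1.
  rewrite sum_sdp_vec -scaler_sumr sumrB -scaler_sumr !sumr_const A2 /sdp_v0.
  have -> : \sum_(i in A) indic [set i] = indic A :> 'rV[R]_n.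
    apply/rowP => j; rewrite summxE mxE; under eq_bigr => i _ do rewrite mxE inE.
    case: (boolP (j \in A)) => jA.
      rewrite (bigD1 j) //= eqxx big1 ?addr0 // => i /andP[_ ij].
      by rewrite eq_sym (negPf ij).
    by rewrite big1 // => i iA; case: eqP jA => // ->; rewrite iA.
  rewrite scaler_nat subrr scaler0; congr sdp_vec; by field.
- rewrite (sum_centers (fun x => l2norm (sdp_vec (2 / 3) (3^-1 *: x)) ^+ 2)).
  under eq_bigr => i _.
    rewrite sqr_l2norm dotp_sdp_vec dotpZl dotpZr dotp_indic1 !inE eqxx mulr1n.
    over.
  rewrite sumr_const card_ord -mulr_natr.
  have : (2 * n)%:R <= (3 * k)%:R :> R by rewrite ler_nat.
  rewrite !natrM /=; lra.
Qed.

End CompleteGraph.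

(** Expanding one factor of <v_0, v_0> = 1 as the sum of the v_{p,c} turns each term <v_{p,c}, v_0>
    into a squared norm. The SDP cost of a point is therefore a weighted average of its connection
    costs. *)
Lemma sdp_mass (R : realType) (I : instance R) m (v0 : 'rV_m)
    (v : points I -> centers I -> 'rV_m) (u : centers I -> 'rV_m)
    (p : points I) :
  sdp_feasible v0 v u -> \sum_c l2norm (v p c) ^+ 2 = 1.
Proof.
case=> v0_unit [v_v0 _] _ v_sum _; rewrite -v0_unit.
have /subr0_eq {1}<- : \sum_c v p c - v0 = 0 by apply: dotp_eq0; rewrite -sqr_l2norm.
by rewrite dotp_suml; apply: eq_bigr => c _; rewrite v_v0.
Qed.

Lemma natr_bin2 (R : comPzRingType) n : 2 * 'C(n, 2)%:R = n%:R * (n%:R - 1) :> R.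
Proof.
rewrite -natrM mulnC -[2%N]/(2`!) bin_ffact ffactnSr ffactn1 natrM.
by case: n => [|n]; rewrite ?mul0r // subn1 -(natr1 n) addrK.
Qed.

(** * Relaxation value, separation and integral cost of the complete-graph instance *)

Section CompleteGraphGap.
Context {R : realType} (pb : problem) (n k : nat).

Local Notation I := (@complete_instance R n k).

(** The solution above puts weight only on centers at cost 1, and by [sdp_mass] no solution does
    better, since every connection cost is at least 1. *)
Lemma sdp_value_complete : (2 * n <= 3 * k)%N ->
  sdp_value pb I = ('C(n, 2)%:R)%:E.
Proof.
move=> kn; have feas := @sdp_feasible_complete R n k kn.
have card_sum : \sum_(p : points I) 1 = 'C(n, 2)%:R :> R.
  by rewrite sumr_const -(@card_points R n k) cardfE.
apply/eqP; rewrite eq_le; apply/andP; split.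
  apply: ereal_inf_lbound.
  exists (1 + (n + n))%N, (sdp_v0 n), (@sdp_v R n k), (@sdp_u R n k).
  split=> //; congr (_%:E); rewrite -card_sum; apply: eq_bigr => p _.
  rewrite -(sdp_mass p feas); apply: eq_bigr => c _.
  have [A A2 ep] := pointP p; have [i ec] := centerP c.
  rewrite /sdp_v ep ec cost_center // dotp_indic1.
  case: (i \in A); rewrite ?eqxx ?mulr1 // eq_sym oner_eq0.
  by rewrite sqr_l2norm dotp0l mul0r.
apply: le_ereal_inf_tmp => _ [m [v0 [v [u [v_feas ->]]]]].
rewrite lee_fin -card_sum; apply: ler_sum => p _.
rewrite -(sdp_mass p v_feas); apply: ler_sum => c _.
rewrite -[leLHS]mulr1 ler_wpM2l ?sqr_ge0 //.
have [A A2 ->] := pointP p; have [i ->] := centerP c.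
by rewrite cost_center //; case: ifP => _; lra.
Qed.

Lemma scale_instance1 (J : instance R) : scale_instance 1 J = J.
Proof.
case: J => d P C b; rewrite /scale_instance /=.
have scale1 (X : {fset 'rV[R]_d}) : [fset 1 *: x | x in X]%fset = X.
  apply/fsetP => x; apply/imfsetP/idP => [[y /= yX ->]|xX]; first by rewrite scale1r.
  by exists x => //; rewrite scale1r.
by rewrite !scale1.
Qed.

Lemma well_separated_complete : (1 < n)%N -> (2 * n <= 3 * k)%N ->
  well_separated pb I.
Proof.
(* The average SDP cost is already 1, so no rescaling takes place; [n_gt1] ensures that there is a
   point to average over. *)
move=> n_gt1 kn; exists 1; rewrite ?ltr01 // scale_instance1 /=; split.
  rewrite /avg_sdp_cost sdp_value_complete // card_points -EFinM divff //.
  by rewrite pnatr_eq0 -lt0n bin_gt0.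
have indicP x : x \in (points I `|` centers I)%fset -> exists A, x = indic A.
  case/fsetUP => /imfsetP[y /= _ ->]; first by exists y.
  by exists [set y].
move=> _ _ /indicP[A ->] /indicP[B ->] neqAB; apply: pdist_indic_ge1.
by apply: contraNneq neqAB => ->.
Qed.

(** Let [T] be the set of vertices whose centers are closed. It has at least n - |S| elements, edges
    inside [T] pay at least 3, and all other edges pay at least 1. *)
Lemma integral_cost_complete_ge (S : {set centers I}) :
  (('C(n, 2)%:R + 2 * 'C(n - #|S|, 2)%:R)%:E <= integral_cost pb S)%E.
Proof.
pose T : {set 'I_n} := [set i | [forall (c | c \in S), val c != indic [set i]]].
have T_card : (n - #|S| <= #|T|)%N.
  rewrite leq_subLR -[X in (X <= _)%N](card_ord n) -(cardsC T) addnC leq_add2r.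
  rewrite -(card_imset _ Some_inj).
  (* [idx] recovers the vertex of a center, as an option. Its image of [S] contains every vertex
     outside [T], so there are at most |S| of these. *)
  pose idx (c : centers I) := [pick i : 'I_n | val c == indic [set i]].
  apply: leq_trans (leq_imset_card idx (mem S)).
  apply/subset_leq_card/subsetP => _ /imsetP[i iT ->]; apply/imsetP.
  move: iT; rewrite !inE negb_forall_in => /exists_inP[c cS].
  rewrite negbK => /eqP ci; exists c => //; rewrite /idx ci.
  by case: pickP => [j /eqP/indic1_inj ->|/(_ i)] //; rewrite eqxx.
(* A real lower bound for the minimum, valid also for empty [S], where the minimum is [+oo]. Being a
   function of the vector, it can be summed by [sum_points]. *)
pose G (x : 'rV[R]_n) : R :=
  if [exists (c | c \in S), dotp x (val c) == 1] then 1 else 3.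
have G_le (p : points I) : ((G (val p))%:E <=
    \big[mine/+oo]_(c in S) (conn_cost pb (val p) (val c))%:E)%E.
  apply: le_bigmin => [|c cS]; first exact: leey.
  have [A A2 ep] := pointP p; have [i ec] := centerP c.
  rewrite lee_fin ep ec cost_center // /G.
  case: ifPn => [_|]; first by case: ifP => _; lra.
  rewrite negb_exists_in => /forall_inP/(_ c cS).
  by rewrite ec dotp_indic1; case: (i \in A); rewrite ?eqxx.
apply: (@le_trans _ _ (\sum_(p : points I) (G (val p))%:E)%E);
  last exact: lee_sum.
rewrite sumEFin lee_fin sum_points.
apply: (@le_trans _ _ (\sum_(A : {set 'I_n} | #|A| == 2) (1 + 2 * (A \subset T)%:R))).
  have card_sum (P : pred {set 'I_n}) :
      \sum_(A | P A) 1 = #|[set A | P A]|%:R :> R.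
    by rewrite -sum1dep_card natr_sum.
  rewrite big_split -mulr_sumr /= card_sum card_draws card_ord.
  have -> : \sum_(A : {set 'I_n} | #|A| == 2) (A \subset T)%:R =
      \sum_(A : {set 'I_n} | (#|A| == 2) && (A \subset T)) 1 :> R.
    by rewrite big_mkcondr; apply: eq_bigr => A _; case: ifP.
  rewrite card_sum.
  rewrite (_ : [set _ | _] = [set A : {set 'I_n} | A \subset T & #|A| == 2]); last first.
    by apply/setP => A; rewrite !inE andbC.
  by rewrite cards_draws lerD2l ler_pM2l ?ltr0n // ler_nat leq_bin2l.
apply: ler_sum => A A2; rewrite /G.
case: (boolP (A \subset T)) => AT; last by case: ifP => _; rewrite mulr0; lra.
case: ifPn => [/exists_inP[c cS]|_]; last by rewrite mulr1n; lra.
have [i ec] := centerP c; rewrite ec dotp_indic1.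
case: (boolP (i \in A)) => [iA|]; last by rewrite eq_sym oner_eq0.
by have := subsetP AT i iA; rewrite inE => /forall_inP/(_ c cS); rewrite ec eqxx.
Qed.

Lemma opt_integral_complete_ge (b : R) (t : nat) : t%:R + b <= n%:R ->
  (('C(n, 2)%:R + 2 * 'C(t, 2)%:R)%:E <= opt_integral pb I b)%E.
Proof.
move=> tb; apply: le_bigmin => [|S Sb]; first exact: leey.
apply: le_trans (integral_cost_complete_ge S).
rewrite lee_fin lerD2l ler_pM2l ?ltr0n // ler_nat leq_bin2l //.
rewrite leq_subRL -?(ler_nat R) ?natrD.
  by rewrite addrC (le_trans _ tb) // lerD2l.
(* The bound |S| <= n, required because the subtraction n - |S| is truncated. *)
by apply: (le_trans Sb); apply: le_trans tb; rewrite lerDr.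
Qed.

End CompleteGraphGap.

Theorem theorem3p26 (R : realType) (pb : problem) (eps : R) (eps_gt0 : 0 < eps) :
  exists (delta : R) (F : set (instance R)),
    [/\ 0 < delta,
        infinite_set [set budget I | I in F]%classic,
        forall I : instance R, F I -> well_separated pb I
      & forall I : instance R, F I ->
          ((149 / 125 - eps)%:E * sdp_value pb I
             <= opt_integral pb I ((budget I)%:R + delta * (budget I)%:R))%E].
Proof.
(* These sizes give k = 2n/3 exactly and make k/100 an integer. *)
pose K m := @complete_instance R (300 * m.+1) (200 * m.+1).
have K_sdp m : (2 * (300 * m.+1) <= 3 * (200 * m.+1))%N by rewrite !mulnA.
exists 100^-1, (range K); split; first by rewrite invr_gt0 ltr0n.
- rewrite image_comp (eq_finite_set (inj_card_eq _)); first exact: infinite_nat.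
  by move=> m1 m2 _ _ /= /eqP; rewrite eqn_pmul2l // eqSS => /eqP.
- by move=> _ [m _ <-]; apply: well_separated_complete => //; rewrite mulnS.
move=> _ [m _ <-]; rewrite sdp_value_complete //=.
(* With delta = 1/100, at most 202 (m + 1) centers open, leaving at least 98 (m + 1) vertices
   uncovered. *)
have budget_le : (98 * m.+1)%:R + ((200 * m.+1)%:R + 100^-1 * (200 * m.+1)%:R)
    <= (300 * m.+1)%:R :> R by rewrite !natrM; lra.
apply: le_trans (opt_integral_complete_ge pb _ budget_le).
have := (natr_bin2 R (300 * m.+1), natr_bin2 R (98 * m.+1)).
rewrite -EFinM lee_fin !natrM.
set x : R := m.+1%:R; have x_ge1 : 1 <= x by rewrite ler1n.
case=> eq_n eq_t.
have : 0 <= eps * 'C(300 * m.+1, 2)%:R by rewrite mulr_ge0 // ltW.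
(* It suffices that 2 C(98x, 2) >= (24/125) C(300x, 2). After expansion this is 964 x^2 >= 69.2 x,
   which holds for x >= 1. *)
nra.
Qed.
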